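(* Let $\mathfrak{A}$ be a residuated lattice. The following assertions are equivalent: (1) $\mathfrak{A}$ is a $\star$-residuated lattice; (2) $\tau_h$ and $\tau_d$ coincide on $Min(\mathfrak{A})$; (3) $(Min(\mathfrak{A});\tau_h)$ is compact.
   Context: A residuated lattice is an algebra $\mathfrak{A}=(A;\vee,\wedge,\odot,\rightarrow,0,1)$ such that $(A;\vee,\wedge,0,1)$ is a bounded lattice, $(A;\odot,1)$ is a commutative monoid, and $(\odot,\rightarrow)$ is an adjoint pair, i.e. $x\odot y\le z$ iff $x\le y\rightarrow z$. A filter of $\mathfrak{A}$ is a non-empty subset $F\subseteq A$ such that $x,y\in F$ implies $x\odot y\in F$, and $x\in F$, $y\in A$ imply $x\vee y\in F$. A filter is proper if it is not equal to $A$. A proper filter $P$ is prime if for all filters $F_1,F_2$, $F_1\cap F_2=P$ implies $F_1=P$ or $F_2=P$. $Min(\mathfrak{A})$ is the set of minimal prime filters (minimal elements, under inclusion, among all prime filters). For $X\subseteq A$ let $X^{\perp}=\{a\in A\mid x\vee a=1 \text{ for all } x\in X\}$, $x^\perp=\{x\}^\perp$ and $x^{\perp\perp}=(x^\perp)^\perp$. $\mathfrak{A}$ is a $\star$-residuated lattice if for every $x\in A$ there exists $y\in A$ with $x^{\perp\perp}=y^{\perp}$. For $X\subseteq A$ let $h(X)=\{P\in Min(\mathfrak{A})\mid X\subseteq P\}$, and $h(x)=h(\{x\})$. The hull-kernel topology $\tau_h$ on $Min(\mathfrak{A})$ is the topology whose closed sets are the sets $h(X)$, $X\subseteq A$. The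 dual hull-kernel topology $\tau_d$ on $Min(\mathfrak{A})$ is the topology having $\{h(x)\mid x\in A\}$ as a base of open sets. Compactness does not include the Hausdorff condition. *)

(* Defs.v *)
From HB Require Import structures.
From mathcomp Require Import all_boot all_order.
From mathcomp Require Import boolp classical_sets topology.

Set Implicit Arguments.
Unset Strict Implicit.
Unset Printing Implicit Defensive.

Import Order.TTheory.
Local Open Scope order_scope.
(* Opened last: [~`], [`&`] and [`|`] are the set operations, and lattice joins
   are written [Order.join]. *)
Local Open Scope classical_set_scope.

(* [Order.TBLattice] does not assume [\bot != \top], so the one-element
   residuated lattice is allowed. *)
HB.mixin Record isResiduatedLattice (d : Order.disp_t) A
    of Order.TBLattice d A := {
  rmul : A -> A -> A;
  rimp : A -> A -> A;
  rmulA : associative rmul;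
  rmulC : commutative rmul;
  rmul1x : left_id (\top : A) rmul;
  rmul_adj : forall x y z : A, (rmul x y <= z) = (x <= rimp y z)
}.

#[short(type="residuatedLatticeType")]
HB.structure Definition ResiduatedLattice (d : Order.disp_t) :=
  {A of isResiduatedLattice d A & Order.TBLattice d A}.

Section Definitions.
Context {d : Order.disp_t} {A : residuatedLatticeType d}.
Implicit Types (F P Q X : set A) (x y : A).

Definition rfilter F : Prop :=
  [/\ F !=set0,
      forall x y, F x -> F y -> F (rmul x y) &
      forall x y, F x -> F (Order.join x y)].

Definition proper_rfilter F : Prop := rfilter F /\ F <> setT.

Definition prime_rfilter P : Prop :=
  proper_rfilter P /\
  forall F1 F2, rfilter F1 -> rfilter F2 -> F1 `&` F2 = P ->
    F1 = P \/ F2 = P.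

Definition min_prime_rfilter P : Prop :=
  prime_rfilter P /\ forall Q, prime_rfilter Q -> Q `<=` P -> Q = P.

Definition perp X : set A :=
  [set a | forall x, X x -> Order.join x a = \top].

End Definitions.

Definition star_residuated {d : Order.disp_t} (A : residuatedLatticeType d) :
    Prop :=
  forall x : A, exists y : A, perp (perp [set x]) = perp [set y].

Definition minspec {d : Order.disp_t} (A : residuatedLatticeType d) : Type :=
  set_type (@min_prime_rfilter d A).

Definition hull {d : Order.disp_t} {A : residuatedLatticeType d} (X : set A) :
    set (minspec A) :=
  [set P | X `<=` \val P].

(* Two copies of [minspec A], so that each can carry its own topology. *)
Definition hull_kernel {d : Order.disp_t} (A : residuatedLatticeType d) :
  Type := minspec A.
Definition dual_hull_kernel {d : Order.disp_t} (A : residuatedLatticeType d) :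
  Type := minspec A.

Section BasicFacts.
Context {d : Order.disp_t} {A : residuatedLatticeType d}.
Implicit Types (F P : set A) (x y z : A).

Lemma rmul_monol x y z : x <= y -> rmul x z <= rmul y z.
Proof. by move=> xy; rewrite rmul_adj (le_trans xy)// -rmul_adj. Qed.

Lemma rmul_lel x y : rmul x y <= x.
Proof.
by rewrite rmulC; have := rmul_monol x (lex1 y); rewrite rmul1x.
Qed.

Lemma rmul_joinl x y z :
  rmul (Order.join x y) z = Order.join (rmul x z) (rmul y z).
Proof.
apply/eqP; rewrite eq_le; apply/andP; split.
  by rewrite rmul_adj leUx -!rmul_adj leUl leUr.
by rewrite leUx !rmul_monol ?leUl ?leUr.
Qed.

Lemma rmul_join_le x y z :
  rmul (Order.join x z) (Order.join y z) <= Order.join (rmul x y) z.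
Proof.
rewrite rmul_joinl leUx; apply/andP; split; last first.
  by rewrite (le_trans (rmul_lel _ _))// leUr.
rewrite rmulC rmul_joinl leUx rmulC leUl /=.
by rewrite (le_trans (rmul_lel _ _))// leUr.
Qed.

Lemma rfilter_le F x y : rfilter F -> x <= y -> F x -> F y.
Proof. by move=> [_ _ FU] /join_idPl <- Fx; rewrite joinC; exact: FU. Qed.

Lemma rfilter_mul F x y : rfilter F -> F x -> F y -> F (rmul x y).
Proof. by move=> [_ FM _]; exact: FM. Qed.

Lemma rfilter1 F : rfilter F -> F \top.
Proof.
by move=> Ff; have [[x Fx] _ _] := Ff; exact: (rfilter_le Ff (lex1 x) Fx).
Qed.

Lemma rfilter_residual P (S : set A) : rfilter P ->
  rfilter [set w | forall z, S z -> P (Order.join w z)].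
Proof.
move=> Pf; split.
- by exists \top => z _ /=; rewrite join1x; exact: rfilter1.
- move=> x y /= Px Py z Sz; apply: (rfilter_le Pf (rmul_join_le x y z)).
  by apply: rfilter_mul => //; [exact: Px | exact: Py].
- move=> x y /= Px z Sz; apply: (rfilter_le Pf _ (Px _ Sz)).
  by rewrite leUx leUr andbT -joinA leUl.
Qed.

Lemma prime_rfilter_join P x y : prime_rfilter P ->
  P (Order.join x y) -> P x \/ P y.
Proof.
move=> [[Pf _] Pirr] Pxy.
pose G := [set w | forall z, [set y] z -> P (Order.join w z)].
pose H := [set w | forall z, G z -> P (Order.join w z)].
have GHP : G `&` H = P.
  rewrite eqEsubset; split=> [z [Gz Hz]|z Pz].
    by have := Hz _ Gz; rewrite joinxx.
  by split=> w _; apply: (rfilter_le Pf _ Pz); rewrite leUl.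
have [GP|HP] := Pirr G H (rfilter_residual _ Pf) (rfilter_residual _ Pf) GHP.
- by left; rewrite -GP => _ ->.
- by right; rewrite -HP => z /(_ _ erefl); rewrite joinC.
Qed.

Lemma minspec_min (P : minspec A) : min_prime_rfilter (\val P).
Proof. by case: P => P /= /set_mem. Qed.

Lemma minspec_prime (P : minspec A) : prime_rfilter (\val P).
Proof. by have [] := minspec_min P. Qed.

Lemma minspec_rfilter (P : minspec A) : rfilter (\val P).
Proof. by have [[]] := minspec_prime P. Qed.

End BasicFacts.

Section HullKernel.
Context (d : Order.disp_t) (A : residuatedLatticeType d).

HB.instance Definition _ := Choice.copy (hull_kernel A) (minspec A).

Definition hull_kernel_open : set (set (hull_kernel A)) :=
  [set U | exists X : set A, ~` U = hull X].

Lemma hull_kernel_openT : hull_kernel_open setT.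
Proof.
exists setT; rewrite eqEsubset; split=> P; first by case; exact: I.
move=> TP.
have [[_ PT] _] := minspec_prime P.
by case: PT; rewrite eqEsubset; split.
Qed.

Lemma hull_kernel_openI : setI_closed hull_kernel_open.
Proof.
move=> U V [X UX] [Y VY].
exists [set Order.join x y | x in X & y in Y].
rewrite setCI UX VY eqEsubset; split=> P /=.
  have [_ _ PU] := minspec_rfilter P.
  move=> PXY _ [x Xx [y Yy <-]].
  by case: PXY => h; [|rewrite joinC]; apply: PU; apply: h.
move=> PXY; apply: contrapT => /not_orP[].
move=> /existsNP[x /not_implyP[Xx Px]] /existsNP[y /not_implyP[Yy Py]].
have : \val P (Order.join x y) by apply: PXY; exists x => //; exists y.
by case/(prime_rfilter_join (minspec_prime P)).
Qed.

Lemma hull_kernel_open_bigU (I : Type) (f : I -> set (hull_kernel A)) :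
  (forall i, hull_kernel_open (f i)) -> hull_kernel_open (\bigcup_i f i).
Proof.
move=> /choice[X fX]; exists (\bigcup_i X i).
rewrite setC_bigcup eqEsubset; split=> P.
  by move=> Pf x [i _ Xix]; have : (~` f i) P by [exact: Pf]; rewrite fX; apply.
by move=> PX i _; rewrite fX => x Xix; apply: PX; exists i.
Qed.

HB.instance Definition _ := isOpenTopological.Build (hull_kernel A)
  hull_kernel_openT hull_kernel_openI hull_kernel_open_bigU.

Lemma hull_kernel_closedE (C : set (hull_kernel A)) :
  closed C <-> exists X : set A, C = hull X.
Proof.
rewrite -openC; split=> [[X CX]|[X ->]].
  by exists X; rewrite -CX setCK.
by exists X; rewrite setCK.
Qed.

End HullKernel.

Section DualHullKernel.
Context (d : Order.disp_t) (A : residuatedLatticeType d).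

HB.instance Definition _ := Choice.copy (dual_hull_kernel A) (minspec A).

Definition dual_hull_kernel_base : set (set (dual_hull_kernel A)) :=
  [set hull [set x] | x in [set: A]].

Lemma dual_hull_kernel_cover :
  \bigcup_(B in dual_hull_kernel_base) B = setT.
Proof.
rewrite eqEsubset; split=> // P _; exists (hull [set \top]); first by exists \top.
by move=> _ ->; exact: rfilter1 (minspec_rfilter P).
Qed.

Lemma dual_hull_kernel_join (B C : set (dual_hull_kernel A)) P :
  dual_hull_kernel_base B -> dual_hull_kernel_base C -> B P -> C P ->
  exists D, [/\ dual_hull_kernel_base D, D P & D `<=` B `&` C].
Proof.
move=> [x _ <-] [y _ <-] Px Py; exists (hull [set rmul x y]); split.
- by exists (rmul x y).
- by move=> _ ->; apply: rfilter_mul (minspec_rfilter P) _ _; [exact: Px|exact: Py].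
- move=> Q Qxy; have {}Qxy : \val Q (rmul x y) by exact: Qxy.
  split=> _ ->; apply: (rfilter_le (minspec_rfilter Q) _ Qxy).
    exact: rmul_lel.
  by rewrite rmulC; exact: rmul_lel.
Qed.

HB.instance Definition _ := isBaseTopological.Build (dual_hull_kernel A)
  dual_hull_kernel_cover dual_hull_kernel_join.

Lemma dual_hull_kernel_openE (U : set (dual_hull_kernel A)) :
  open U <-> exists X : set A, U = \bigcup_(x in X) hull [set x].
Proof.
split=> [[D DB <-]|[X ->]].
  exists [set x | D (hull [set x])]; rewrite eqEsubset; split=> P.
    by move=> [B DB' BP]; have [x _ xB] := DB _ DB'; exists x; rewrite /= ?xB.
  by move=> [x Dx xP]; exists (hull [set x]).
exists [set hull [set x] | x in X]; first by move=> _ [x _ <-]; exists x.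
by rewrite bigcup_image.
Qed.

End DualHullKernel.

Definition tau_h {d : Order.disp_t} (A : residuatedLatticeType d) :
  set (set (minspec A)) := @open (hull_kernel A).
Definition tau_d {d : Order.disp_t} (A : residuatedLatticeType d) :
  set (set (minspec A)) := @open (dual_hull_kernel A).

Arguments tau_h {d} A _.
Arguments tau_d {d} A _.

(* Main.v *)
(** The complement of a minimal prime filter is a maximal join-closed set avoiding [\top].  Zorn's
    lemma therefore provides minimal primes missing any given join-closed set that avoids [\top],
    and shows that [x] lies in a minimal prime [P] iff some [t] outside [P] satisfies
    [Order.join x t = \top].  Hence [h(x)] and [h(x^perp)] are complementary, so that [h(x)] is
    always clopen for [tau_h].  If [x^perp^perp = y^perp] then [h(x)] and [h(y)] are complementary,
    which gives (1) => (2).  The topology [tau_d] is always compact: given a proper filter, the [y]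
    for which [h(y)] has its complement in the filter form a join-closed set avoiding [\top], and
    any minimal prime missing it is a cluster point; this gives (2) => (3).  Under (3), compactness
    turns the empty intersection of [h(x)] with all [h(y)], [y] in [x^perp], into a single such [y]
    with [h(x)] and [h(y)] disjoint, and then [x^perp^perp = y^perp]. *)
Require Import Defs.
From mathcomp Require Import all_boot all_order.
From mathcomp Require Import boolp classical_sets topology.

Set Implicit Arguments.
Unset Strict Implicit.
Unset Printing Implicit Defensive.

Import Order.TTheory.
Local Open Scope order_scope.
Local Open Scope classical_set_scope.

Section MinimalPrimes.
Context {d : Order.disp_t} {A : residuatedLatticeType d}.
Implicit Types (x y z : A) (S T : set A) (P : minspec A).

Definition join_closed S := forall x y, S x -> S y -> S (Order.join x y).

Lemma maximal_join_closed S : join_closed S -> ~ S \top ->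
  exists T, [/\ S `<=` T, join_closed T, ~ T \top &
    forall T', T `<=` T' -> join_closed T' -> ~ T' \top -> T' `<=` T].
Proof.
move=> SU S1.
(* Joining [S] to every set makes the empty chain harmless. *)
pose Q := [set T | join_closed (S `|` T) /\ ~ (S `|` T) \top].
have [F FQ Ftot|M [[MU M1] Mmax]] := @Zorn_bigcup A Q.
  split=> [x y|]; last first.
    by case=> // -[X FX X1]; have [_] := FQ _ FX; apply; right.
  move=> [Sx|[X FX Xx]] [Sy|[Y FY Yy]].
  - by left; exact: SU.
  - have [YU _] := FQ _ FY.
    by have [|||] := YU x y; [left|right|left|right; exists Y].
  - have [XU _] := FQ _ FX.
    by have [|||] := XU x y; [right|left|left|right; exists X].
  - have [XY|YX] := Ftot _ _ FX FY.
    + have [YU _] := FQ _ FY.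
      by have [|||] := YU x y; [right; exact: XY|right|left|right; exists Y].
    + have [XU _] := FQ _ FX.
      by have [|||] := XU x y; [right|right; exact: YX|left|right; exists X].
exists (S `|` M); split=> // T' MT' T'U T'1.
have ST' : S `|` T' = T' by apply/setUidPr => x Sx; apply: MT'; left.
apply: contrapT => T'M; apply: (Mmax T'); last by split; rewrite ST'.
split=> [x Mx|T'M']; first by apply: MT'; right.
by apply: T'M => x /T'M' Mx; right.
Qed.

(** The prime is the complement of a maximal join-closed [T] containing [S]. The last clause keeps
    the witnesses that make it minimal. *)
Lemma min_prime_avoiding S : S \bot -> join_closed S -> ~ S \top ->
  exists P, (forall x, S x -> ~ \val P x) /\
    forall x, \val P x -> exists2 t, ~ \val P t & Order.join x t = \top.
Proof.
move=> S0 SU S1; have [T [ST TU T1 Tmax]] := maximal_join_closed SU S1.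
have T0 : T \bot by exact: ST.
have TP x : ~ T x -> exists2 t, T t & Order.join x t = \top.
  move=> Tx; apply: contrapT => noT; apply: Tx.
  (* Without a witness, adjoining [x] and its joins with [T] still avoids [\top], so maximality puts
     [x] in [T]. *)
  apply: (Tmax [set z | T z \/ exists2 t, T t & z = Order.join x t]).
  - by move=> z Tz; left.
  - move=> a b [Ta|[t Tt ->]] [Tb|[u Tu ->]].
    + by left; exact: TU.
    + by right; exists (Order.join a u); [exact: TU | rewrite joinCA].
    + by right; exists (Order.join t b); [exact: TU | rewrite joinA].
    + right; exists (Order.join t u); first exact: TU.
      by rewrite joinACA joinxx.
  - by case=> // -[t Tt xt]; apply: noT; exists t.
  - by right; exists \bot => //; rewrite joinx0.
have PT x t : T t -> Order.join x t = \top -> ~ T x.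
  by move=> Tt xt Tx; apply: T1; rewrite -xt; exact: TU.
have Pf : rfilter (~` T).
  split; first by exists \top.
  - move=> x y /TP[t Tt xt] /TP[u Tu yu].
    (* Joining [t] and [u] gives a common witness for both factors, and [rmul_join_le] carries it to
       the product. *)
    apply: (PT _ (Order.join t u)); first exact: TU.
    apply/eqP; rewrite -le1x.
    apply: (le_trans _ (rmul_join_le x y (Order.join t u))).
    by rewrite joinA xt join1x joinCA yu joinx1 rmul1x.
  - move=> x y /TP[t Tt xt]; apply: (PT _ t) => //.
    by rewrite joinAC xt join1x.
have Pprime : prime_rfilter (~` T).
  split; first by split=> // PE; have : (~` T) \bot by rewrite PE.
  move=> F1 F2 F1f F2f F12; apply: contrapT => /not_orP[F1P F2P].
  have outside F : ~` T `<=` F -> F <> ~` T -> exists2 a, F a & T a.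
    move=> PF FP; apply: contrapT => noF; apply: FP; rewrite eqEsubset; split=> //.
    by move=> a Fa Ta; apply: noF; exists a.
  have [a F1a Ta] : exists2 a, F1 a & T a by apply: outside; rewrite // -F12 => ? [].
  have [b F2b Tb] : exists2 b, F2 b & T b by apply: outside; rewrite // -F12 => ? [].
  have : (F1 `&` F2) (Order.join a b).
    split; first exact: (rfilter_le F1f (leUl a b) F1a).
    exact: (rfilter_le F2f (leUr b a) F2b).
  by rewrite F12; apply; exact: TU.
have Pmin : min_prime_rfilter (~` T).
  (* A smaller prime [Q] contains [\top], the join of [x] and [t], but not [t]; hence it contains
     [x]. *)
  split=> // Q Qprime QT; rewrite eqEsubset; split=> // x /TP[t Tt xt].
  have : Q (Order.join x t) by rewrite xt; apply: rfilter1; have [[]] := Qprime.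
  by case/(prime_rfilter_join Qprime) => // /QT.
exists (exist _ (~` T) (mem_set Pmin)); split=> [x /ST Tx|x /TP[t Tt xt]]; first exact.
by exists t => //; exact.
Qed.

Lemma minspec_bot P : ~ \val P \bot.
Proof.
have [[Pf PT] _] := minspec_prime P => P0; apply: PT; rewrite eqEsubset; split=> // x _.
exact: (rfilter_le Pf (le0x x) P0).
Qed.

(** A minimal prime missing the complement of [P] lies inside [P], so it equals [P], which inherits
    its witnesses. *)
Lemma minspec_compl P x : \val P x ->
  exists2 t, ~ \val P t & Order.join x t = \top.
Proof.
move=> Px; have Pf := minspec_rfilter P.
have [||Q [QP Qc]] := @min_prime_avoiding (~` \val P) (@minspec_bot P).
- by move=> a b Pa Pb /(prime_rfilter_join (minspec_prime P))[].
- by apply; exact: rfilter1.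
have QsubP : \val Q `<=` \val P by move=> z Qz; apply: contrapT => /QP.
have QE := (minspec_min P).2 _ (minspec_prime Q) QsubP.
by rewrite -QE in Px *; exact: Qc.
Qed.

Lemma minspec_perp P x y : Order.join x y = \top -> ~ \val P x -> \val P y.
Proof.
move=> xy Px; have : \val P (Order.join x y).
  by rewrite xy; exact: rfilter1 (minspec_rfilter P).
by case/(prime_rfilter_join (minspec_prime P)).
Qed.

Lemma eq_top_minspec x : (forall P, \val P x) -> x = \top.
Proof.
move=> Px; apply: contrapT => x1.
have [|||P [xP _]] := @min_prime_avoiding [set z | z <= x].
- exact: le0x.
- by move=> a b /= ax bx; rewrite leUx ax.
- by rewrite /= le1x => /eqP.
- by apply: (xP x); [exact: lexx | exact: Px].
Qed.

Lemma perp1E x y : perp [set x] y <-> Order.join x y = \top.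
Proof. by split=> [|xy _ ->//]; apply. Qed.

Lemma hull1E P x : hull [set x] P <-> \val P x.
Proof. by split=> [|Px _ ->//]; apply. Qed.

(** If [P] contained both, the witnesses [s] for [x] and [t] for [y] would be outside [P] yet join
    to [\top]. That [P] contains one of them holds because [x] lies in its double perp. *)
Lemma perp_perp_complement x y : perp (perp [set x]) = perp [set y] ->
  forall P, \val P y <-> ~ \val P x.
Proof.
move=> xy P; split=> [/minspec_compl[t Pt yt] Px|Px].
  have [s Ps xs] := minspec_compl Px.
  have /(_ s) : perp (perp [set x]) t by rewrite xy; exact/perp1E.
  by move=> /(_ (proj2 (perp1E _ _) xs)) /minspec_perp/(_ Ps).
apply: (minspec_perp _ Px); rewrite joinC; apply/perp1E.
by rewrite -xy => a /perp1E; rewrite joinC.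
Qed.

(** By [eq_top_minspec], a join is [\top] as soon as every minimal prime contains it. *)
Lemma perp_perpE x y : (forall P, \val P y <-> ~ \val P x) ->
  perp (perp [set x]) = perp [set y].
Proof.
move=> xy; rewrite eqEsubset; split=> a.
  move=> xa; apply/perp1E/xa/perp1E/eq_top_minspec => P.
  have Pf := minspec_rfilter P; have [Px|/xy Py] := pselect (\val P x).
    exact: (rfilter_le Pf (leUl x y) Px).
  exact: (rfilter_le Pf (leUr y x) Py).
move=> /perp1E ya b /perp1E xb; apply: eq_top_minspec => P.
have Pf := minspec_rfilter P; have [Px|Px] := pselect (\val P x).
  have Py : ~ \val P y by move/xy.
  exact: (rfilter_le Pf (leUr a b) (minspec_perp ya Py)).
exact: (rfilter_le Pf (leUl b a) (minspec_perp xb Px)).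
Qed.

End MinimalPrimes.

Section Topologies.
Context {d : Order.disp_t} (A : residuatedLatticeType d).

Lemma tau_hE (U : set (minspec A)) :
  tau_h A U <-> exists X : set A, U = \bigcup_(x in X) ~` hull [set x].
Proof.
have hullE (X : set A) : ~` hull X = \bigcup_(x in X) ~` hull [set x].
  rewrite -setC_bigcap; congr (~` _); rewrite eqEsubset; split=> P.
    by move=> XP x Xx; apply/hull1E/XP.
  by move=> XP x /XP/hull1E.
split=> [[X UX]|[X ->]]; exists X; first by rewrite -hullE -UX setCK.
by rewrite -hullE setCK.
Qed.

Lemma hull1_compl (x : A) : ~` hull [set x] = hull (perp [set x]).
Proof.
rewrite eqEsubset; split=> P.
  by move=> xP y /perp1E xy; apply: (minspec_perp xy) => /hull1E.
move=> xP /hull1E/minspec_compl[t Pt xt]; apply: Pt.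
exact/xP/perp1E.
Qed.

Lemma tau_h_hull1 (x : A) : tau_h A (hull [set x]).
Proof. by exists (perp [set x]); exact: hull1_compl. Qed.

Lemma tau_d_hull1 (x : A) : tau_d A (hull [set x]).
Proof.
by apply/dual_hull_kernel_openE; exists [set x]; rewrite bigcup_set1.
Qed.

Lemma tau_d_subset_tau_h : tau_d A `<=` tau_h A.
Proof.
move=> U /dual_hull_kernel_openE[X ->].
by apply: (@bigcup_open (hull_kernel A)) => x _; exact: tau_h_hull1.
Qed.

Lemma star_tau_eq : star_residuated A -> tau_h A = tau_d A.
Proof.
move=> star; rewrite eqEsubset; split; last exact: tau_d_subset_tau_h.
move=> U /tau_hE[X ->].
apply: (@bigcup_open (dual_hull_kernel A)) => x _.
have [y /perp_perp_complement xy] := star x.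
rewrite (_ : ~` _ = hull [set y]); first exact: tau_d_hull1.
rewrite eqEsubset; split=> P.
  by move=> Px; apply/hull1E/xy => /hull1E.
by move=> /hull1E/xy Px /hull1E.
Qed.

Lemma dual_hull_kernel_compact : compact [set: dual_hull_kernel A].
Proof.
move=> F FF _.
pose S := [set y : A | F (~` hull [set y])].
have [|||P [PS _]] := @min_prime_avoiding _ _ S.
- apply: filterS filterT => P _ /hull1E; exact: minspec_bot.
- move=> x y Sx Sy; apply: filterS (filterI Sx Sy) => P [Px Py] /hull1E.
  by case/(prime_rfilter_join (minspec_prime P)) => /hull1E.
- rewrite /S /= => F0; apply: (@filter_not_empty _ F).
  apply: filterS F0 => P; apply; apply/hull1E.
  exact: rfilter1 (minspec_rfilter P).
exists P; split=> // B C FB; rewrite nbhsE => -[U [Uop UP] UC].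
have [X UX] := (dual_hull_kernel_openE U).1 Uop.
move: UP; rewrite UX => -[x Xx /hull1E Px].
(* If [B] missed [C], it would miss [hull [set x]], which would put [x] in [S]. *)
apply: contrapT => BC0; apply: (PS x) => //.
apply: filterS FB => Q BQ Qx; apply: BC0; exists Q; split=> //.
by apply: UC; rewrite UX; exists x.
Qed.

Lemma tau_eq_compact : tau_h A = tau_d A -> compact [set: hull_kernel A].
Proof.
move=> hd F FF _; have [P [_ PF]] := @dual_hull_kernel_compact F FF filterT.
exists P; split=> // B C FB; rewrite nbhsE => -[U [Uop UP] UC].
apply: PF => //; rewrite nbhsE; exists U => //; split=> //.
by have : tau_d A U by rewrite -hd.
Qed.

Lemma compact_star : compact [set: hull_kernel A] -> star_residuated A.
Proof.
move=> cA x.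
suff [y xy xy0] : exists2 y : A, Order.join x y = \top &
    forall P : minspec A, \val P x -> ~ \val P y.
  exists y; apply: perp_perpE => P.
  by split=> [Py /xy0//|]; exact: minspec_perp.
apply: contrapT => noy.
(* The filter generated by the sets where [hull [set x]] meets [hull [set y]], for [y] in [perp
   [set x]]; it is proper because no suitable [y] exists. *)
pose F : set_system (hull_kernel A) := [set B | exists2 y : A,
  Order.join x y = \top & forall P : minspec A, \val P x -> \val P y -> B P].
have FF : ProperFilter F.
  split; first by move=> [y xy y0]; apply: noy; exists y.
  split.
  - by exists \top; rewrite ?joinx1.
  - move=> B C [y xy yB] [z xz zC]; exists (rmul y z).
      apply/eqP; rewrite -le1x joinC.
      apply: le_trans (rmul_join_le y z x).
      by rewrite joinC xy joinC xz rmul1x.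
    move=> P Px Pyz; have Pf := minspec_rfilter P; split.
      by apply: yB => //; exact: (rfilter_le Pf (rmul_lel y z) Pyz).
    apply: zC => //; apply: (rfilter_le Pf _ Pyz).
    by rewrite rmulC; exact: rmul_lel.
  - by move=> B C BC [y xy yB]; exists y => // P Px Py; exact/BC/yB.
have [P [_ PF]] := cA F FF filterT.
have Pmem (C : set A) : F (hull C) -> hull C P.
  move=> FC; have : closed (hull C : set (hull_kernel A)).
    by apply/hull_kernel_closedE; exists C.
  by apply=> B; exact: PF.
have Px : \val P x.
  by apply/hull1E/Pmem; exists \top; rewrite ?joinx1// => Q Qx _; exact/hull1E.
(* Minimality gives [t] in [perp [set x]] outside [P], but [hull [set t]] is closed and belongs to
   [F], so it contains the cluster point [P]. *)
have [t Pt xt] := minspec_compl Px; apply: Pt.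
by apply/hull1E/Pmem; exists t => // Q _ Qt; exact/hull1E.
Qed.

End Topologies.

Theorem theorem4p6 (d : Order.disp_t) (A : residuatedLatticeType d) :
  [<-> star_residuated A;
       tau_h A = tau_d A;
       compact [set: hull_kernel A]%classic].
Proof.
tfae; [exact: star_tau_eq | exact: tau_eq_compact | exact: compact_star].
Qed.
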